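(* Let $R$ be a duo ring. Then $R$ is a principal ideal ring if and only if every finitely generated left $R$-module $M$ has a decomposition $M=Z\oplus P$, where $Z$ is a Noetherian cu-serial module and $P$ is a direct sum of projective virtually simple modules.
   Context: All rings are associative with identity and all modules are unitary left modules. A ring is duo if every left ideal and every right ideal is two-sided. A principal ideal ring is a ring in which every left ideal and every right ideal is principal. For a module $K$, $\mathrm{Rad}(K)$ denotes the intersection of all maximal submodules of $K$ (equal to $K$ if there are none). A nonzero module is uniform if every nonzero submodule is essential. A left $R$-module $M$ is cyclic-uniform uniserial (cu-uniserial) if for every finitely generated submodule $0\neq K\subseteq M$, $K/\mathrm{Rad}(K)$ is cyclic and uniform; $M$ is cu-serial if it is a direct sum of cu-uniserial modules. A module $M$ is virtually simple if $M\neq 0$ and $N\cong M$ for every nonzero submodule $N$ of $M$. *)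

(* Defs.v *)
From HB Require Import structures.
From mathcomp Require Import all_boot all_order all_algebra.
From mathcomp Require Import boolp.

Set Implicit Arguments.
Unset Strict Implicit.
Unset Printing Implicit Defensive.

Import GRing.Theory.
Local Open Scope ring_scope.
Local Open Scope quotient_scope.

(* One-sided ideals and submodules are boolean predicates.  Since [boolp] turns
   every proposition into a boolean, they range over all ideals and submodules.
   Rings are [pzRingType]s: possibly noncommutative, the zero ring allowed. *)

Definition left_ideal (R : pzRingType) (I : {pred R}) : Prop :=
  zmod_closed I /\ (forall a x : R, x \in I -> a * x \in I).

Definition right_ideal (R : pzRingType) (I : {pred R}) : Prop :=
  zmod_closed I /\ (forall a x : R, x \in I -> x * a \in I).

Definition two_sided_ideal (R : pzRingType) (I : {pred R}) : Prop :=
  left_ideal I /\ right_ideal I.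

Definition duo_ring (R : pzRingType) : Prop :=
  (forall I : {pred R}, left_ideal I -> two_sided_ideal I) /\
  (forall I : {pred R}, right_ideal I -> two_sided_ideal I).

Definition principal_ideal_ring (R : pzRingType) : Prop :=
  (forall I : {pred R}, left_ideal I ->
     exists a : R, forall x : R, x \in I <-> exists r : R, x = r * a) /\
  (forall I : {pred R}, right_ideal I ->
     exists a : R, forall x : R, x \in I <-> exists r : R, x = a * r).

Section SubmoduleAsModule.
Variables (R : pzRingType) (M : lmodType R) (N : submodClosed M).

Record submod : Type := Submod { submod_val : M; _ : submod_val \in N }.

HB.instance Definition _ := [isSub for submod_val].
HB.instance Definition _ := [Choice of submod by <:].
HB.instance Definition _ := [SubChoice_isSubLmodule of submod by <:].

End SubmoduleAsModule.

(* Library quotients ([Quotient.quot]) are by a [zmodClosed] predicate, and only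
   carry the additive structure: the scaling is added here. *)
Section QuotientModule.
Variables (R : pzRingType) (M : lmodType R) (N : submodClosed M).

Definition submod_pred : M -> bool := fun x => x \in N.

Lemma submod_pred_zmod_closed : zmod_closed submod_pred.
Proof. exact: GRing.submod_closedB (submodClosedP N). Qed.

HB.instance Definition _ :=
  GRing.isZmodClosed.Build M submod_pred submod_pred_zmod_closed.

Definition submod_zmod : zmodClosed M :=
  GRing.ZmodClosed.clone M submod_pred _.

Definition quotmod : Type := Quotient.quot submod_zmod.

HB.instance Definition _ := GRing.Zmodule.on quotmod.

Definition pi_quotmod (x : M) : quotmod := \pi_(Quotient.quot submod_zmod) x.

Definition scale_quotmod (a : R) (x : quotmod) : quotmod :=
  pi_quotmod (a *: repr x).

Lemma pi_quotmod_eq (x y : M) : (pi_quotmod x = pi_quotmod y) <-> x - y \in N.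
Proof.
rewrite /pi_quotmod -[x - y \in N]/(x - y \in submod_pred) Quotient.idealrBE.
by split=> /eqP.
Qed.

Lemma pi_quotmodD (x y : M) :
  pi_quotmod (x + y) = pi_quotmod x + pi_quotmod y.
Proof. exact: (raddfD (\pi_(Quotient.quot submod_zmod))). Qed.

Lemma pi_quotmod_repr (x : quotmod) : pi_quotmod (repr x) = x.
Proof. exact: reprK. Qed.

Lemma scale_pi_quotmod (a : R) (x : M) :
  scale_quotmod a (pi_quotmod x) = pi_quotmod (a *: x).
Proof.
apply/pi_quotmod_eq; rewrite -scalerBr.
by apply: rpredZ; apply/pi_quotmod_eq; rewrite pi_quotmod_repr.
Qed.

Lemma scale_quotmodA a b (x : quotmod) :
  scale_quotmod a (scale_quotmod b x) = scale_quotmod (a * b) x.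
Proof. by rewrite -[x]pi_quotmod_repr !scale_pi_quotmod scalerA. Qed.

Lemma scale_quotmod1 : left_id 1 scale_quotmod.
Proof. by move=> x; rewrite -[x]pi_quotmod_repr scale_pi_quotmod scale1r. Qed.

Lemma scale_quotmodDr : right_distributive scale_quotmod +%R.
Proof.
move=> a x y; rewrite -[x]pi_quotmod_repr -[y]pi_quotmod_repr.
by rewrite -pi_quotmodD !scale_pi_quotmod -pi_quotmodD scalerDr.
Qed.

Lemma scale_quotmodDl (x : quotmod) :
  {morph scale_quotmod^~ x : a b / a + b}.
Proof.
move=> a b; rewrite -[x]pi_quotmod_repr.
by rewrite !scale_pi_quotmod -pi_quotmodD scalerDl.
Qed.

HB.instance Definition _ := GRing.Zmodule_isLmodule.Build R quotmod
  scale_quotmodA scale_quotmod1 scale_quotmodDr scale_quotmodDl.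

End QuotientModule.

Definition nonzero_module (R : pzRingType) (M : lmodType R) : Prop :=
  exists x : M, x != 0.

Definition finitely_generated (R : pzRingType) (M : lmodType R) : Prop :=
  exists (n : nat) (g : 'I_n -> M),
    forall x : M, exists c : 'I_n -> R, x = \sum_(i < n) c i *: g i.

Definition cyclic_module (R : pzRingType) (M : lmodType R) : Prop :=
  exists g : M, forall x : M, exists a : R, x = a *: g.

Definition isomorphic_modules (R : pzRingType) (M N : lmodType R) : Prop :=
  exists f : {linear M -> N}, bijective f.

Definition noetherian_module (R : pzRingType) (M : lmodType R) : Prop :=
  forall N : nat -> submodClosed M,
    (forall n, {subset N n <= N n.+1}) ->
    exists n, forall m, (n <= m)%N -> N m =i N n.

Definition projective_module (R : pzRingType) (P : lmodType R) : Prop :=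
  forall (A B : lmodType R) (g : {linear A -> B}) (f : {linear P -> B}),
    (forall b : B, exists a : A, g a = b) ->
    exists h : {linear P -> A}, forall x : P, g (h x) = f x.

Definition essential_submod (R : pzRingType) (M : lmodType R)
    (N : submodClosed M) : Prop :=
  forall L : submodClosed M,
    (exists2 x, x \in L & x != 0) ->
    exists x, [/\ x \in N, x \in L & x != 0].

Definition uniform_module (R : pzRingType) (M : lmodType R) : Prop :=
  nonzero_module M /\
  forall N : submodClosed M, nonzero_module (submod N) -> essential_submod N.

Definition maximal_submod (R : pzRingType) (M : lmodType R)
    (N : submodClosed M) : Prop :=
  (exists x : M, x \notin N) /\
  forall L : submodClosed M, {subset N <= L} ->
    L =i N \/ (forall x : M, x \in L).

Section Radical.
Variables (R : pzRingType) (M : lmodType R).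

Definition in_Rad : M -> bool := fun x =>
  `[< forall N : submodClosed M, maximal_submod N -> x \in N >].

Lemma in_Rad_closed : GRing.subsemimod_closed in_Rad.
Proof.
split; first split.
- by apply/asboolP => N _; exact: rpred0.
- move=> x y /asboolP Rx /asboolP Ry; apply/asboolP => N maxN.
  by apply: rpredD; [exact: Rx | exact: Ry].
- move=> a x /asboolP Rx; apply/asboolP => N maxN.
  by apply: rpredZ; exact: Rx.
Qed.

HB.instance Definition _ := GRing.isSubmodClosed.Build R M in_Rad in_Rad_closed.

Definition Rad : submodClosed M := GRing.SubmodClosed.clone R M in_Rad _.

End Radical.

Definition cu_uniserial (R : pzRingType) (M : lmodType R) : Prop :=
  forall K : submodClosed M,
    finitely_generated (submod K) -> nonzero_module (submod K) ->
    cyclic_module (quotmod (Rad (submod K))) /\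
    uniform_module (quotmod (Rad (submod K))).

(* Internal direct sum of a possibly infinite family: every element is a finite
   sum of components, and finite sums of components are independent. *)
Definition internal_direct_sum (R : pzRingType) (M : lmodType R)
    (I : choiceType) (N : I -> submodClosed M) : Prop :=
  (forall x : M, exists (s : seq I) (f : I -> M),
     [/\ uniq s, (forall i, f i \in N i) & x = \sum_(i <- s) f i]) /\
  (forall (s : seq I) (f : I -> M), uniq s -> (forall i, f i \in N i) ->
     \sum_(i <- s) f i = 0 -> forall i, i \in s -> f i = 0).

Definition direct_sum_of (R : pzRingType) (C : lmodType R -> Prop)
    (M : lmodType R) : Prop :=
  exists (I : choiceType) (N : I -> submodClosed M),
    internal_direct_sum N /\ forall i : I, C (submod (N i)).

Definition internal_direct_sum2 (R : pzRingType) (M : lmodType R)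
    (N L : submodClosed M) : Prop :=
  (forall x : M, exists y z : M, [/\ y \in N, z \in L & x = y + z]) /\
  (forall x : M, x \in N -> x \in L -> x = 0).

Definition cu_serial (R : pzRingType) (M : lmodType R) : Prop :=
  direct_sum_of (@cu_uniserial R) M.

Definition virtually_simple (R : pzRingType) (M : lmodType R) : Prop :=
  nonzero_module M /\
  forall N : submodClosed M, nonzero_module (submod N) ->
    isomorphic_modules (submod N) M.

(* Main.v *)
From HB Require Import structures.
Require Import Defs.
From mathcomp Require Import all_boot all_order all_algebra.
From mathcomp Require Import boolp.

(** Why the theorem holds.

    In a duo ring [Ra = aR] for every [a]: a scalar may be moved across another
    one at the price of changing it.  Hence annihilators and colon ideals
    [{r | r *: x \in N}] are two-sided, [{z | a *: z \in N}] and [a *: M] are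
    submodules, and left and right principality are the same condition.

    From decompositions to principal ideals, it is enough to decompose the left
    module [R] itself.  A Noetherian cu-uniserial module has all its submodules
    cyclic, because a module [K] with [K / Rad K] cyclic is cyclic as soon as it
    is Noetherian; so does a virtually simple module, being isomorphic to its
    nonzero cyclic submodules.  The components of [1] in the summands annihilate
    each other, and the generators found for a left ideal inside the summands
    add up to a generator of the whole ideal ([left_principal_of_blocks]).

    Conversely let [R] be a principal ideal duo ring.  Everything rests on a
    dichotomy for (completely) prime ideals: such an ideal is either maximal or
    generated by an idempotent ([prime_maximal_or_idem]).  It suffices to split
    a nonzero cyclic direct summand of the right kind off every nonzero finitely
    generated module [M], because [M] is Noetherian and the process must stop.

    If [M] contains a simple submodule, killed by the maximal ideal [Rp] say,
    let [k + 1] be the exponent of the [p]-power torsion of [M] and let [x] be an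
    element of exact order [p ^+ k.+1].  A submodule [N] maximal among those
    containing [p ^+ k.+1 *: M] and meeting [R x] trivially is a complement of
    [R x] ([torsion_summand]).  A cyclic module killed by a power of [p] is
    cu-uniserial: each of its nonzero submodules [K] is cyclic, and
    [Rad K = p *: K] is a maximal submodule.

    If [M] has no simple submodule, let [N] be a maximal proper submodule such
    that [M / N] has none either.  The primes associated with [M / N] are not
    maximal, hence are generated by idempotents, and maximality of [N] forces
    all of them to be one ideal [R e] and [M / N] to be torsion-free of rank one
    over the domain [R / R e].  As [R] is principal, [M / N] is then cyclic, and
    a suitable lift of its generator spans a complement of [N] isomorphic to
    [R / R e] ([free_summand]).  That module is a direct factor of [R], hence
    projective, and it is virtually simple because [R / R e] is a principal
    ideal domain.

    [Z] collects the summands of the first kind and [P] those of the second. *)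

Set Implicit Arguments.
Unset Strict Implicit.
Unset Printing Implicit Defensive.

Import GRing.Theory.
Local Open Scope ring_scope.

(** * Submodules and generators *)

Section Submodules.
Variables (R : pzRingType) (M : lmodType R).

(** Submodules as plain predicates: sets such as [{z | p *: z \in N}] can then be
    formed freely, and [submodClosed_of] turns them into structures when the
    statement needs it. *)
Definition is_submod (N : M -> Prop) : Prop :=
  [/\ N 0, (forall x y, N x -> N y -> N (x + y))
    & (forall a x, N x -> N (a *: x))].

Lemma is_submodN (N : M -> Prop) x : is_submod N -> N x -> N (- x).
Proof. by case=> _ _ NZ Nx; rewrite -scaleN1r; apply: NZ. Qed.

Lemma is_submodB (N : M -> Prop) x y : is_submod N -> N x -> N y -> N (x - y).
Proof. by move=> sN Nx /(is_submodN sN); case: sN => _ ND _; apply: ND. Qed.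

Lemma submodClosed_is_submod (N : submodClosed M) : is_submod (fun x => x \in N).
Proof.
by split=> [|x y|a x]; [exact: rpred0 | exact: rpredD | exact: rpredZ].
Qed.

Lemma submodClosed_of (N : M -> Prop) : is_submod N ->
  exists K : submodClosed M, forall x, x \in K <-> N x.
Proof.
case=> N0 ND NZ; pose f : M -> bool := fun x => `[< N x >].
have fcl : GRing.subsemimod_closed f.
  split; first split; first exact/asboolP.
    by move=> x y /asboolP Nx /asboolP Ny; apply/asboolP/ND.
  by move=> a x /asboolP Nx; apply/asboolP/NZ.
exists (HB.pack_for (submodClosed M) f (GRing.isSubmodClosed.Build R M f fcl)).
by move=> x; split=> /asboolP.
Qed.

Definition cyc (x : M) : M -> Prop := fun z => exists r, z = r *: x.

(** Left-linear combinations of a list; the recursion peels off one generator, as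
    all inductions on the number of generators below do. *)
Fixpoint lspan (xs : seq M) : M -> Prop :=
  if xs is y :: ys then fun z => exists r, lspan ys (z - r *: y)
  else fun z => z = 0.

Lemma lspan_submod xs : is_submod (lspan xs).
Proof.
elim: xs => [|y ys [S0 SD SZ]] /=.
  by split=> // [x z -> ->|a x ->]; rewrite ?addr0 ?scaler0.
split; first by exists 0; rewrite scale0r subr0.
  move=> x z [r Hr] [s Hs]; exists (r + s).
  by rewrite scalerDl opprD addrACA; apply: SD.
by move=> a x [r Hr]; exists (a * r); rewrite -scalerA -scalerBr; apply: SZ.
Qed.

Lemma lspan_cons y ys z r : lspan ys z -> lspan (y :: ys) (r *: y + z).
Proof. by exists r; rewrite addrAC subrr add0r. Qed.

Lemma lspan_tail y ys z : lspan ys z -> lspan (y :: ys) z.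
Proof. by exists 0; rewrite scale0r subr0. Qed.

Lemma lspan_head y ys r : lspan (y :: ys) (r *: y).
Proof. by exists r; rewrite subrr; case: (lspan_submod ys). Qed.

Lemma lspan_min xs (N : M -> Prop) : is_submod N ->
  (forall x, x \in xs -> N x) -> forall z, lspan xs z -> N z.
Proof.
move=> sN; elim: xs => [|y ys IH] Nxs z /=; first by move=> ->; case: sN.
case=> r /IH Nz; rewrite -[z](subrK (r *: y)).
case: (sN) => _ ND NZ; apply: ND; last by apply/NZ/Nxs; rewrite mem_head.
by apply: Nz => x xin; apply: Nxs; rewrite inE xin orbT.
Qed.

Lemma lspan_mem xs x : x \in xs -> lspan xs x.
Proof.
elim: xs => // y ys IH; rewrite inE => /orP[/eqP <-|/IH]; last exact: lspan_tail.
by have := lspan_head x ys 1; rewrite scale1r.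
Qed.

Lemma lspan_sum xs z : lspan xs z ->
  exists c : nat -> R, z = \sum_(i < size xs) c i *: xs`_i.
Proof.
elim: xs z => [|y ys IH] z /=; first by move=> ->; exists (fun=> 0); rewrite big_ord0.
case=> r /IH[c Hc]; exists (fun i => if i is j.+1 then c j else r).
by rewrite big_ord_recl /= -[z in LHS](subrK (r *: y)) addrC Hc.
Qed.

Lemma finitely_generatedP :
  finitely_generated M <-> exists xs, forall z, lspan xs z.
Proof.
split=> [[n [g Hg]]|[xs Hxs]].
  exists (codom g) => z; have [c ->] := Hg z.
  have [S0 SD SZ] := lspan_submod (codom g).
  apply: (big_ind (lspan (codom g))) => // i _.
  exact/SZ/lspan_mem/codom_f.
exists (size xs), (fun i => xs`_i) => z; have [c ->] := lspan_sum (Hxs z).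
by exists (fun i => c i).
Qed.

Lemma is_submod_cyc x : is_submod (cyc x).
Proof.
split; first by exists 0; rewrite scale0r.
  by move=> _ _ [r ->] [s ->]; exists (r + s); rewrite scalerDl.
by move=> a _ [r ->]; exists (a * r); rewrite scalerA.
Qed.

Definition sumS (N L : M -> Prop) : M -> Prop :=
  fun z => exists x y, [/\ N x, L y & z = x + y].

Lemma is_submod_sumS N L : is_submod N -> is_submod L -> is_submod (sumS N L).
Proof.
move=> [N0 ND NZ] [L0 LD LZ]; split; first by exists 0, 0; rewrite addr0.
  move=> _ _ [x [y [Nx Ly ->]]] [x' [y' [Nx' Ly' ->]]].
  by exists (x + x'), (y + y'); rewrite addrACA; split; auto.
move=> a _ [x [y [Nx Ly ->]]]; exists (a *: x), (a *: y).
by rewrite scalerDr; split; auto.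
Qed.

(** The maximum principle: without a maximal member, dependent choice would build
    a strictly increasing chain. *)
Lemma noetherian_max (F : (M -> Prop) -> Prop) : noetherian_module M ->
  (forall N, F N -> is_submod N) -> (exists N, F N) ->
  exists N, F N /\ forall N', F N' -> (forall x, N x -> N' x) ->
    forall x, N' x -> N x.
Proof.
move=> noeM Fsub [N0 FN0]; apply: contrapT => noMax.
have step (N : {N | F N}) : exists N' : {N | F N},
    (forall x, sval N x -> sval N' x) /\ ~ (forall x, sval N' x -> sval N x).
  case: N => N FN; apply: contrapT => H; apply: noMax; exists N; split=> // N' FN' le.
  apply: contrapT => nle; apply: H.
  by exists (exist _ N' FN').
have [next Hnext] := choice step.
pose ch := fix ch n := if n is m.+1 then next (ch m) else exist _ N0 FN0.
have [K HK] := choice (fun n => submodClosed_of (Fsub _ (svalP (ch n)))).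
have [n Hn] : exists n, forall m, (n <= m)%N -> K m =i K n.
  by apply: noeM => n x /HK Hx; apply/HK; apply: (Hnext (ch n)).1.
apply: (Hnext (ch n)).2 => x Hx; apply/HK; rewrite -(Hn n.+1) //.
exact/HK.
Qed.

(** A maximal finitely generated submodule absorbs every element. *)
Lemma noetherian_fg : noetherian_module M -> finitely_generated M.
Proof.
move=> noeM; apply/finitely_generatedP.
pose F (N : M -> Prop) := exists xs, N = lspan xs.
have [||N [[xs ->] Nmax]] := @noetherian_max F noeM.
- by move=> _ [xs ->]; apply: lspan_submod.
- by exists (lspan [::]), [::].
exists xs => z; apply: (Nmax (lspan (z :: xs))) => [|x|]; first by exists (z :: xs).
  exact: lspan_tail.
by apply: lspan_mem; rewrite mem_head.
Qed.

(** The union of the chain is finitely generated, and its finitely many generators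
    all lie in one member of the chain. *)
Lemma stationary_of_fg (N : nat -> M -> Prop) :
  (forall L, is_submod L -> exists xs, forall x, L x <-> lspan xs x) ->
  (forall n, is_submod (N n)) -> (forall n x, N n x -> N n.+1 x) ->
  exists n, forall m x, (n <= m)%N -> N m x -> N n x.
Proof.
move=> fgM sN incN.
have mono n m x : (n <= m)%N -> N n x -> N m x.
  by move=> /subnK <-; elim: (m - n)%N => // k IH /IH; apply: incN.
have [|xs Hxs] := fgM (fun x => exists n, N n x).
  split; first by exists 0%N; case: (sN 0%N).
    move=> x y [n Nx] [m Ny]; exists (maxn n m); case: (sN (maxn n m)) => _ ND _.
    by apply: ND; [apply: mono Nx; apply: leq_maxl | apply: mono Ny; apply: leq_maxr].
  by move=> a x [n Nx]; exists n; case: (sN n) => _ _; apply.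
have [n Hn] : exists n, forall x, x \in xs -> N n x.
  have : forall x, x \in xs -> exists n, N n x by move=> x /lspan_mem/Hxs.
  elim: (xs) => [|y ys IH] H; first by exists 0%N.
  have [|n Hn] := IH; first by move=> x xin; apply: H; rewrite inE xin orbT.
  have [m Hm] := H y (mem_head _ _).
  exists (maxn n m) => x; rewrite inE => /orP[/eqP->|/Hn Nx].
    by apply: mono Hm; apply: leq_maxr.
  by apply: mono Nx; apply: leq_maxl.
exists n => m x _ Nmx; apply: (lspan_min (sN n) Hn).
by apply/Hxs; exists m.
Qed.

End Submodules.
Arguments cyc {R M}.

(** * Linear maps out of cyclic modules *)

Section CyclicMaps.
Variables (R : pzRingType).

(** A cyclic module [R x] is [R / ann x], so it maps onto [R y] as soon as
    [ann x] is contained in [ann y]. *)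
Lemma cyclic_linear (X Y : lmodType R) (x : X) (y : Y) :
  (forall z, cyc x z) -> (forall r, r *: x = 0 -> r *: y = 0) ->
  exists h : {linear X -> Y}, forall r, h (r *: x) = r *: y.
Proof.
move=> genx ann; have [c Hc] := choice genx.
pose h z := c z *: y.
have hE r : h (r *: x) = r *: y.
  apply/eqP; rewrite -subr_eq0 -scalerBl; apply/eqP/ann.
  by rewrite scalerBl -Hc subrr.
have lin_h : linear h.
  move=> a u v; rewrite {1}(Hc u) {1}(Hc v) scalerA -scalerDl hE.
  by rewrite scalerDl -scalerA.
exists (HB.pack_for {linear X -> Y} h (GRing.isLinear.Build R X Y _ h lin_h)).
exact: hE.
Qed.

Lemma cyclic_iso (X Y : lmodType R) (x : X) (y : Y) :
  (forall z, cyc x z) -> (forall z, cyc y z) ->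
  (forall r, r *: x = 0 <-> r *: y = 0) -> isomorphic_modules X Y.
Proof.
move=> genx geny ann.
have [h hE] := cyclic_linear genx (fun r => (ann r).1).
have [k kE] := cyclic_linear geny (fun r => (ann r).2).
by exists h, k => z; [have [r ->] := genx z | have [r ->] := geny z];
  rewrite ?hE ?kE ?hE.
Qed.

Lemma noetherian_inj (Y Z : lmodType R) (f : {linear Y -> Z}) :
  injective f -> noetherian_module Z -> noetherian_module Y.
Proof.
move=> finj noeZ N incN.
have sfN n : is_submod (fun z => exists2 y, y \in N n & z = f y).
  split; first by exists 0; rewrite ?linear0 ?rpred0.
    by move=> _ _ [y Ny ->] [y' Ny' ->]; exists (y + y'); rewrite ?linearD ?rpredD.
  by move=> a _ [y Ny ->]; exists (a *: y); rewrite ?linearZ ?rpredZ.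
have [K HK] := choice (fun n => submodClosed_of (sfN n)).
have memK n y : (f y \in K n) = (y \in N n).
  apply/idP/idP => [/HK[y' Ny' /finj ->] //|Ny]; by apply/HK; exists y.
have [|n Hn] := noeZ K; first by move=> n x /HK[y Ny ->]; rewrite memK incN.
by exists n => m nm y; rewrite -!memK Hn.
Qed.

Lemma noetherian_submod (M : lmodType R) (N : submodClosed M) :
  noetherian_module M -> noetherian_module (submod N).
Proof. exact: (noetherian_inj (f := val) val_inj). Qed.

End CyclicMaps.

(** * Modules all of whose submodules are cyclic *)

Section CyclicSubmodules.
Variables (R : pzRingType).

Lemma RadP (M : lmodType R) x :
  reflect (forall N : submodClosed M, maximal_submod N -> x \in N) (x \in Rad M).
Proof. exact: asboolP. Qed.

(** A proper cyclic submodule of a Noetherian module lies in a maximal one. *)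
Lemma noetherian_maximal (M : lmodType R) (y : M) :
  noetherian_module M -> (exists z, ~ cyc y z) ->
  exists L : submodClosed M, maximal_submod L /\ y \in L.
Proof.
move=> noeM [z nz].
pose F (N : M -> Prop) := [/\ is_submod N, N y & exists z, ~ N z].
have [_ []//||N [[sN Ny [w nw]] Nmax]] := @noetherian_max R M F noeM.
  exists (cyc y); split; [exact: is_submod_cyc | by exists 1; rewrite scale1r |].
  by exists z.
have [L HL] := submodClosed_of sN.
exists L; split; last exact/HL.
split; first by exists w; apply/negP => /HL.
move=> K LK; have [|nK] := pselect (forall x, x \in K); [by right | left].
move=> x; apply/idP/idP => [xK|]; last exact: LK.
apply/HL; apply: (Nmax (fun x => x \in K)) xK; last by move=> u /HL/LK.
split; [exact: submodClosed_is_submod | exact/LK/HL |].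
by apply: contrapT => H; apply: nK => u; apply: contrapT => uK; apply: H; exists u.
Qed.

(** A Nakayama lemma: if a lift of the generator of [M / Rad M] did not generate
    [M], it would lie in a maximal submodule, which also contains [Rad M] and so
    would be all of [M]. *)
Lemma cyclic_mod_Rad (M : lmodType R) :
  noetherian_module M -> cyclic_module (quotmod (Rad M)) -> cyclic_module M.
Proof.
move=> noeM [g Hg]; exists (repr g) => z; apply: contrapT => nz.
have [|L [maxL yL]] := @noetherian_maximal _ (repr g) noeM; first by exists z.
have [[w /negP wL] _] := maxL.
apply: wL; have [a Ha] := Hg (pi_quotmod (Rad M) w).
have : pi_quotmod (Rad M) w = pi_quotmod (Rad M) (a *: repr g).
  by rewrite -scale_pi_quotmod pi_quotmod_repr Ha.
move=> /pi_quotmod_eq/RadP wR.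
by rewrite -[w](subrK (a *: repr g)) rpredD ?rpredZ //; apply: wR.
Qed.

Definition submods_cyclic (M : lmodType R) : Prop :=
  forall N : submodClosed M, exists g : M, forall x, x \in N <-> cyc g x.

Lemma submods_cyclicP (M : lmodType R) :
  (forall N : submodClosed M, nonzero_module (submod N) ->
    cyclic_module (submod N)) -> submods_cyclic M.
Proof.
move=> cM N; have [nz|z] := pselect (nonzero_module (submod N)).
  have [g Hg] := cM N nz; exists (val g) => x; split=> [xN|[a ->]].
    by have [a /(congr1 val) /= ->] := Hg (Submod xN); exists a.
  by rewrite rpredZ //; case: (g).
exists 0 => x; split=> [xN|[a ->]]; last by rewrite scaler0 rpred0.
exists 0; rewrite scaler0; apply: contrapT => /eqP nx; apply: z.
exists (Submod xN); by apply: contra_neq nx => /(congr1 val).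
Qed.

Lemma cu_uniserial_submods_cyclic (M : lmodType R) :
  noetherian_module M -> cu_uniserial M -> submods_cyclic M.
Proof.
move=> noeM cuM; apply: submods_cyclicP => N nzN.
have noeN := noetherian_submod (N := N) noeM.
by apply: (cyclic_mod_Rad noeN); have [] := cuM N (noetherian_fg noeN) nzN.
Qed.

(** [M] is isomorphic to a nonzero cyclic submodule of itself, hence cyclic; so
    are its nonzero submodules, which are isomorphic to [M]. *)
Lemma virtually_simple_submods_cyclic (M : lmodType R) :
  virtually_simple M -> submods_cyclic M.
Proof.
move=> [[x nx] vsM].
have [g Hg] : cyclic_module M.
  have [K HK] := submodClosed_of (is_submod_cyc x).
  have xK : x \in K by apply/HK; exists 1; rewrite scale1r.
  have [|f [h fh hf]] := vsM K.
    by exists (Submod xK); apply: contra_neq nx => /(congr1 val).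
  exists (f (Submod xK)) => z; have /HK[a Ha] := valP (h z).
  exists a; rewrite -linearZ -[LHS]hf; congr (f _); exact/val_inj.
apply: submods_cyclicP => N nzN; have [f [h fh hf]] := vsM N nzN.
exists (h g) => z; have [a Ha] := Hg (f z); exists a.
by apply: (can_inj fh); rewrite linearZ hf.
Qed.

End CyclicSubmodules.

(** * Duo rings *)

Section Duo.
Variables (R : pzRingType) (duoR : duo_ring R).

Lemma duo_left_ideal (I : {pred R}) (x : R) :
  left_ideal I -> x \in I -> forall r, x * r \in I.
Proof. by move=> lI xI r; have [_ [_]] := duoR.1 I lI; apply. Qed.

Lemma left_ideal_is_submod (I : {pred R}) :
  left_ideal I <-> @is_submod R R^o (fun x => x \in I).
Proof.
split=> [[[I0 IB] IZ]|[I0 ID IZ]].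
  split=> // x y xI yI; rewrite -[y]opprK; apply: (IB) => //.
  by rewrite -sub0r; apply: IB.
split; last exact: IZ.
by split=> // x y xI yI; apply: ID => //; rewrite -mulN1r; apply: IZ.
Qed.

(** [xR] is contained in [Rx], because the left ideal [Rx] is two-sided. *)
Lemma duo_mulL (x r : R) : exists s, x * r = s * x.
Proof.
pose I : {pred R} := fun z => `[< exists s, z = s * x >].
have lI : left_ideal I.
  split; last first.
    by move=> a _ /asboolP[s ->]; apply/asboolP; exists (a * s); rewrite mulrA.
  split; first by apply/asboolP; exists 0; rewrite mul0r.
  move=> _ _ /asboolP[s ->] /asboolP[t ->].
  by apply/asboolP; exists (s - t); rewrite mulrBl.
have xI : x \in I by apply/asboolP; exists 1; rewrite mul1r.
exact: (asboolW (duo_left_ideal lI xI r)).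
Qed.

(** [Rx] is contained in [xR], because the right ideal [xR] is two-sided. *)
Lemma duo_mulR (x r : R) : exists s, r * x = x * s.
Proof.
pose I : {pred R} := fun z => `[< exists s, z = x * s >].
have rI : right_ideal I.
  split; last first.
    by move=> a _ /asboolP[s ->]; apply/asboolP; exists (s * a); rewrite mulrA.
  split; first by apply/asboolP; exists 0; rewrite mulr0.
  move=> _ _ /asboolP[s ->] /asboolP[t ->].
  by apply/asboolP; exists (s - t); rewrite mulrBr.
have xI : x \in I by apply/asboolP; exists 1; rewrite mulr1.
have [[_ lI] _] := duoR.2 I rI; exact: (asboolW (lI r x xI)).
Qed.

Definition left_mult (a x : R) : Prop := exists r, x = r * a.

Definition left_principal : Prop :=
  forall I : R -> Prop, @is_submod R R^o I ->
    exists a, forall x, I x <-> left_mult a x.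

(** A right ideal is two-sided, hence of the form [Ra], and [Ra = aR]. *)
Lemma duo_principalP : principal_ideal_ring R <-> left_principal.
Proof.
split=> [[pl _] I sI|pl].
  have [|a Ha] := pl (fun x => `[< I x >]).
    apply/left_ideal_is_submod; case: sI => I0 ID IZ; split; first exact/asboolP.
      by move=> x y /asboolP Ix /asboolP Iy; apply/asboolP/ID.
    by move=> b x /asboolP Ix; apply/asboolP/IZ.
  exists a => x; split=> [Ix|/(Ha x)/asboolP //].
  by apply/(Ha x)/asboolP.
have plI (I : {pred R}) : left_ideal I ->
    exists a, forall x, x \in I <-> exists r, x = r * a.
  by move=> /left_ideal_is_submod/pl.
split=> // I rI; have [lI _] := duoR.2 I rI.
have [a Ha] := plI I lI; exists a => x; rewrite Ha; split=> -[r ->].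
  exact: duo_mulR.
exact: duo_mulL.
Qed.

(** The [W k] are two-sided ideals with trivial pairwise intersections, so the
    [E k] act on them as orthogonal idempotents with sum [1].  For a left ideal
    [L], pick generators [a k] of the intersections of [L] with [W k]: every [x]
    in [L] is the sum of the [x * E k], and [E k] extracts [a k] from the sum of
    all the [a l], so that this sum generates [L]. *)
Lemma left_principal_of_blocks (K : choiceType) (W : K -> R^o -> Prop) (E : K -> R)
    (s : seq K) :
  (forall k, is_submod (W k)) -> (forall k, W k (E k)) ->
  (forall k l x, k != l -> W k x -> W l x -> x = 0) ->
  (forall k (L : R^o -> Prop), is_submod L -> exists a : R,
     forall x, (L x /\ W k x) <-> left_mult a x) ->
  uniq s -> 1 = \sum_(k <- s) E k ->
  left_principal.
Proof.
move=> sW WE disj prin us one L sL.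
have [a Ha] := choice (fun k => prin k L sL).
have aP k : L (a k) /\ W k (a k) by apply/Ha; exists 1; rewrite mul1r.
have WR k x r : W k x -> W k (x * r).
  by move=> Wx; have [t ->] := duo_mulL x r; case: (sW k) => _ _; apply.
have LR x r : L x -> L (x * r).
  by move=> Lx; have [t ->] := duo_mulL x r; case: sL => _ _; apply.
have orth k l : k != l -> E k * a l = 0.
  move=> kl; apply: (disj k l _ kl); first exact: WR.
  by case: (sW l) => _ _; apply; case: (aP l).
have Ea k : k \in s -> E k * (\sum_(l <- s) a l) = a k.
  move=> ks; rewrite mulr_sumr (bigD1_seq k) //= big1 ?addr0; last first.
    by move=> j jk; rewrite orth // eq_sym.
  rewrite -[RHS]mul1r one mulr_suml (bigD1_seq k) //= [X in _ = _ + X]big1 ?addr0 //.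
  by move=> j jk; apply: orth.
exists (\sum_(k <- s) a k) => x; split=> [Lx|[r ->]]; last first.
  case: (sL) => L0 LD LZ; apply: LZ; apply: (big_ind L) => // k _.
  by case: (aP k).
have H k : exists r, x * E k = r * a k.
  apply/Ha; split; first exact: LR.
  by case: (sW k) => _ _; apply.
have [c Hc] := choice H.
exists (\sum_(k <- s) c k * E k).
rewrite -[LHS]mulr1 one mulr_sumr [RHS]mulr_suml.
by apply: eq_big_seq => k ks; rewrite Hc -mulrA Ea.
Qed.

End Duo.
Arguments left_mult {R}.

(** * Components of a summand *)

Section Inner.
Variables (R : pzRingType) (M : lmodType R) (D : submodClosed M).

(** The statement nests submodules, a summand of [D] being a submodule of
    [submod D]; this is the same summand seen inside [M]. *)
Definition inner (N : submodClosed (submod D)) : M -> Prop :=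
  fun x => exists2 z : submod D, z \in N & x = val z.

Lemma is_submod_inner (N : submodClosed (submod D)) : is_submod (inner N).
Proof.
split; first by exists 0; rewrite ?rpred0.
  by move=> _ _ [y Ny ->] [z Nz ->]; exists (y + z); rewrite ?rpredD.
by move=> a _ [y Ny ->]; exists (a *: y); rewrite ?rpredZ.
Qed.

Lemma inner_cyclic (N : submodClosed (submod D)) (L : M -> Prop) :
  submods_cyclic (submod N) -> is_submod L ->
  exists a, forall x, L x /\ inner N x <-> cyc a x.
Proof.
move=> cN [L0 LD LZ].
have [|K HK] := @submodClosed_of _ (submod N) (fun z => L (val (val z))).
  by split=> //= [x y|a x]; [apply: LD | apply: LZ].
have [g Hg] := cN K; exists (val (val g)) => x; split.
  move=> [Lx [z Nz xE]].
  have /HK/Hg[a Ha] : L (val (val (Submod Nz))) by rewrite /= -xE.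
  by exists a; rewrite xE -[z]/(val (Submod Nz)) Ha.
move=> [a ->]; have /Hg/HK La : cyc g (a *: g) by exists a.
by split=> //; exists (a *: val g); rewrite ?rpredZ //; case: (g).
Qed.

(** A common element [y] gives the relation [y - y = 0] between two different
    summands. *)
Lemma inner_disjoint (I : choiceType) (N : I -> submodClosed (submod D)) i j x :
  internal_direct_sum N -> i != j -> inner (N i) x -> inner (N j) x -> x = 0.
Proof.
move=> [_ ind] ij [y Ny xy] [z Nz xz].
have zy : z = y by apply: val_inj; rewrite -xy -xz.
pose f k := if k == i then y else if k == j then - z else 0.
have Nf k : f k \in N k.
  rewrite /f; case: eqP => [->//|_]; case: eqP => [->|_]; last exact: rpred0.
  by rewrite -scaleN1r rpredZ.
have us : uniq [:: i; j] by rewrite /= inE ij.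
have := ind _ f us Nf; rewrite !big_cons big_nil /f !eqxx eq_sym (negPf ij) addr0.
by rewrite zy subrr => /(_ erefl i (mem_head _ _)); rewrite eqxx xy => ->.
Qed.

End Inner.

(** * From decompositions to principal ideals *)

Section Converse.
Variables (R : pzRingType) (duoR : duo_ring R).

(** The blocks are all the summands of [Z] and of [P] together, indexed by a sum
    type. *)
Lemma left_principal_of_decomposition (Z P : submodClosed R^o) :
  internal_direct_sum2 Z P ->
  noetherian_module (submod Z) -> cu_serial (submod Z) ->
  direct_sum_of (@virtually_simple R) (submod P) -> left_principal R.
Proof.
move=> [sumZP capZP] noeZ [I [N [dN cN]]] [J [L [dL cL]]].
have [y [z [yZ zP one]]] := sumZP 1.
have [s [f [us Nf yE]]] := dN.1 (Submod yZ).
have [t [g [ut Lg zE]]] := dL.1 (Submod zP).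
pose W (k : I + J) := match k with inl i => inner (N i) | inr j => inner (L j) end.
pose E (k : I + J) : R := match k with inl i => val (f i) | inr j => val (g j) end.
have inZ i x : inner (N i) x -> x \in Z by move=> [u _ ->]; exact: valP.
have inP j x : inner (L j) x -> x \in P by move=> [u _ ->]; exact: valP.
apply: (@left_principal_of_blocks _ duoR _ W E (map inl s ++ map inr t)).
- by move=> [i|j]; apply: is_submod_inner.
- by move=> [i|j]; [exists (f i) | exists (g j)].
- move=> [i|i] [j|j] x ij /=.
  + by apply: inner_disjoint.
  + by move=> /inZ xZ /inP; apply: capZP.
  + by move=> /inP xP /inZ xZ; apply: capZP.
  + by apply: inner_disjoint.
- move=> [i|j] K sK /=.
    have cycN := cu_uniserial_submods_cyclic (noetherian_submod noeZ) (cN i).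
    by have [a Ha] := inner_cyclic cycN sK; exists a.
  have cycL := virtually_simple_submods_cyclic (cL j).
  by have [a Ha] := inner_cyclic cycL sK; exists a.
- rewrite cat_uniq !map_inj_uniq ?us ?ut ?andbT /=; try by move=> ? ? [].
  by apply/hasPn => _ /mapP[j _ ->]; apply/mapP => -[].
rewrite one big_cat /= !big_map; congr (_ + _).
  by rewrite -[y]/(val (Submod yZ)) yE linear_sum.
by rewrite -[z]/(val (Submod zP)) zE linear_sum.
Qed.

End Converse.

(** * Ideals of principal duo rings *)

Section PrincipalDuo.
Variables (R : pzRingType) (duoR : duo_ring R) (pidR : left_principal R).

(** Hilbert style induction on the number of generators: the coefficients at the
    first generator of the elements of [N] form a left ideal, principal by
    hypothesis, and a lift of its generator reduces [N] to its part spanned by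
    the remaining generators. *)
Lemma lspan_submod_fg (M : lmodType R) (xs : seq M) (N : M -> Prop) :
  is_submod N -> (forall z, N z -> lspan xs z) ->
  exists ys, forall z, N z <-> lspan ys z.
Proof.
elim: xs N => [|y ys IH] N sN Nxs.
  by exists [::] => z; split=> [/Nxs//|/= ->]; case: sN.
have [S0 SD SZ] := lspan_submod ys.
have [N0 ND NZ] := sN.
have [|a Ha] := pidR (I := fun r : R => exists z, N z /\ lspan ys (z - r *: y)).
  split; first by exists 0; rewrite scale0r subr0.
    move=> r s [z [Nz Sz]] [w [Nw Sw]]; exists (z + w); split; first exact: ND.
    by rewrite scalerDl opprD addrACA; apply: SD.
  move=> b r [z [Nz Sz]]; exists (b *: z); split; first exact: NZ.
  by rewrite -scalerA -scalerBr; apply: SZ.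
have [z0 [Nz0 Sz0]] : exists z, N z /\ lspan ys (z - a *: y).
  by apply/Ha; exists 1; rewrite mul1r.
have [||zs Hzs] := IH (fun z => N z /\ lspan ys z).
- by split=> // [u v [Nu Su] [Nv Sv]|b u [Nu Su]]; split; auto.
- by move=> z [].
exists (z0 :: zs) => z; split=> [Nz|[r /Hzs[Nzr _]]]; last first.
  by rewrite -[z](subrK (r *: z0)); apply: ND => //; apply: NZ.
have [r Sr] := Nxs z Nz.
have [s rE] : left_mult a r by apply/Ha; exists z.
exists s; apply/Hzs; split; first by apply: is_submodB => //; apply: NZ.
have -> : z - s *: z0 = (z - r *: y) - s *: (z0 - a *: y).
  rewrite rE scalerBr scalerA opprB.
  by rewrite addrA subrK.
by apply: is_submodB => //; apply: SZ.
Qed.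

Lemma fg_noetherian (M : lmodType R) : finitely_generated M -> noetherian_module M.
Proof.
move=> /finitely_generatedP[xs Hxs] N incN.
have [|||n Hn] := @stationary_of_fg R M (fun n x => x \in N n).
- by move=> L sL; apply: (lspan_submod_fg (xs := xs)).
- by move=> n; apply: submodClosed_is_submod.
- by move=> n x; apply: incN.
exists n => m nm x; apply/idP/idP; first exact: Hn.
by move: nm => /subnK <-; elim: (m - n)%N => // k IH /IH; apply: incN.
Qed.

Lemma regular_noetherian : noetherian_module R^o.
Proof.
apply/fg_noetherian/finitely_generatedP; exists [:: 1] => z; exists z.
by rewrite /= -[z *: _]/(z * 1) mulr1 subrr.
Qed.

Lemma is_submod_left_mult a : @is_submod R R^o (@left_mult R a).
Proof. exact: (@is_submod_cyc R R^o a). Qed.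

Lemma left_mult_mulr (a x y : R) : left_mult a x -> left_mult a (x * y).
Proof.
move=> [r ->]; have [s E] := duo_mulL duoR a y.
by exists (r * s); rewrite -mulrA E mulrA.
Qed.

Lemma left_mult_mull (a x y : R) : left_mult a x -> left_mult a (y * x).
Proof. by move=> [r ->]; exists (y * r); rewrite mulrA. Qed.

Lemma left_mult_id (a : R) : left_mult a a.
Proof. by exists 1; rewrite mul1r. Qed.

(** Complete primeness; for two-sided ideals of a duo ring it coincides with
    primeness. *)
Definition prime_ideal (P : R -> Prop) : Prop :=
  ~ P 1 /\ forall x y, P (x * y) -> P x \/ P y.

(** The ideal [Rp] is maximal, phrased so that it can be used on scalars: each [r]
    is either a multiple of [p] or invertible modulo [p]. *)
Definition maximal_gen (p : R) : Prop :=
  ~ left_mult p 1 /\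
  forall r, left_mult p r \/ exists s t, 1 = s * r + t * p.

(** Colon ideals are left ideals, hence closed under right multiplication. *)
Lemma colon_scale (M : lmodType R) (N : M -> Prop) r s x :
  is_submod N -> N (r *: x) -> N (r *: (s *: x)).
Proof.
move=> [_ _ NZ] Nrx; rewrite scalerA; have [t ->] := duo_mulL duoR r s.
by rewrite -scalerA; apply: NZ.
Qed.

Lemma is_submod0 (M : lmodType R) : @is_submod R M (fun x => x = 0).
Proof. by split=> // [x y -> ->|a x ->]; rewrite ?addr0 ?scaler0. Qed.

Lemma is_submod_colon (M : lmodType R) (N : M -> Prop) x :
  is_submod N -> @is_submod R R^o (fun r : R => N (r *: x)).
Proof.
move=> [N0 ND NZ]; split; first by rewrite scale0r.
  by move=> r s Nr Ns; rewrite scalerDl; apply: ND.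
by move=> a r Nr; rewrite -scalerA; apply: NZ.
Qed.

(** Existence of associated primes of [M / N]: a maximal element among the colon
    ideals of the elements of [G] is completely prime, because passing from [w]
    to a multiple outside [N] can only enlarge the colon ideal.  The class [G]
    serves to impose a further condition on the element found. *)
Lemma exists_prime_colon (M : lmodType R) (N G : M -> Prop) :
  is_submod N -> (exists w, G w) -> (forall w, G w -> ~ N w) ->
  (forall s w, G w -> ~ N (s *: w) -> G (s *: w)) ->
  exists w a, [/\ G w, prime_ideal (left_mult a)
    & forall r, N (r *: w) <-> left_mult a r].
Proof.
move=> sN [w0 Gw0] GN GZ.
pose F (I : R^o -> Prop) := exists w, G w /\ I = fun r : R => N (r *: w).
have [||I [[w [Gw ->]] Imax]] := @noetherian_max _ _ F regular_noetherian.
- by move=> _ [w [_ ->]]; apply: is_submod_colon.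
- by exists (fun r : R => N (r *: w0)), w0.
have [a Ha] := pidR (is_submod_colon w sN).
have E : left_mult a = fun r : R => N (r *: w).
  by apply/funext => r; apply/propext; rewrite Ha.
exists w, a; split=> //.
rewrite E; split; first by rewrite scale1r; apply: GN.
move=> x y; rewrite -scalerA => Nxy.
have [Ny|Ny] := pselect (N (y *: w)); [by right | left].
apply: (Imax (fun r : R => N (r *: (y *: w)))) Nxy => [|r Nr].
  by exists (y *: w); split=> //; apply: GZ.
exact: colon_scale.
Qed.

(** Write [J = Rc], so that [a = c * d]; as [c] is not in the prime ideal [Ra],
    [d = t * a] is, and [1 - c * t] kills [a].  So every ideal strictly above a
    prime [Ra] is comaximal with the annihilator of [a]. *)
Lemma above_prime (a b : R) (J : R -> Prop) :
  prime_ideal (left_mult a) -> @is_submod R R^o J -> (forall x, left_mult a x -> J x) ->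
  J b -> ~ left_mult a b -> exists x j, [/\ 1 = x + j, x * a = 0 & J j].
Proof.
move=> [_ prime_a] sJ aJ Jb nab; have [c Hc] := pidR sJ.
have nac : ~ left_mult a c.
  by move=> ac; apply: nab; have /Hc[r ->] := Jb; apply: left_mult_mull.
have [r aE] : left_mult c a by apply/Hc/aJ/left_mult_id.
have [d dE] := duo_mulR duoR c r.
have [//|[t tE]] : left_mult a c \/ left_mult a d.
  by apply: prime_a; rewrite -dE -aE; apply: left_mult_id.
exists (1 - c * t), (c * t); split; first by rewrite subrK.
  by rewrite mulrBl mul1r -mulrA -tE -dE -aE subrr.
have [s ->] := duo_mulL duoR c t; apply/Hc; by exists s.
Qed.

Lemma idem_comm (e r : R) : e * e = e -> e * r = r * e.
Proof.
move=> ee; have [s sE] := duo_mulL duoR e r; have [t tE] := duo_mulR duoR e r.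
have E1 : e * r * e = e * r by rewrite sE -mulrA ee.
by rewrite -E1 -mulrA tE mulrA ee.
Qed.

(** Let [A] be the annihilator of [a].  If [A] is contained in [Ra], then by
    [above_prime] every ideal strictly above [Ra] contains [1], so [Ra] is
    maximal.  Otherwise [above_prime] applies to [A + Ra] itself:
    [1 = z + t * a] with [z * a = 0], and [t * a] is an idempotent generator. *)
Lemma prime_maximal_or_idem (a : R) : prime_ideal (left_mult a) ->
  maximal_gen a \/ exists e, e * e = e /\ left_mult a = left_mult e.
Proof.
move=> pa; have [na1 _] := pa.
pose A := fun x : R^o => (x : R) * a = 0.
have sA : is_submod A.
  split; first exact: mul0r.
    by move=> x y xa ya; rewrite /A mulrDl xa ya addr0.
  by move=> b x xa; rewrite /A -mulrA xa mulr0.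
have sP := is_submod_left_mult a; have [P0 _ _] := sP; have [A0 _ _] := sA.
have [AP|] := pselect (forall x, A x -> left_mult a x).
  left; split=> // r; have [|nar] := pselect (left_mult a r); [by left | right].
  pose J := sumS (cyc (r : R^o)) (left_mult a).
  have sJ : is_submod J by apply: is_submod_sumS => //; apply: is_submod_cyc.
  have [||x [j [E xa [_ [_ [[s ->] [t ->] jE]]]]]] := above_prime pa sJ _ _ nar.
  - move=> x ax; exists 0, x; rewrite add0r; split=> //.
    by case: (is_submod_cyc (r : R^o)).
  - by exists r, 0; rewrite addr0; split=> //; exists 1; rewrite scale1r.
  have [u uE] := AP x xa; exists s, (u + t).
  by rewrite E jE uE mulrDl addrCA.
move=> /existsNP[x /not_implyP[Ax nax]]; right.
have sJ : is_submod (sumS A (left_mult a)) by exact: is_submod_sumS.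
have [||z [j [E za [u [v [ua [t ->] jE]]]]]] := above_prime pa sJ _ _ nax.
- by move=> y ay; exists 0, y; rewrite add0r.
- by exists x, 0; rewrite addr0.
have eae : (t * a) * a = a.
  rewrite -[RHS]mul1r E mulrDl za add0r jE mulrDl.
  by rewrite [X in _ = X + _](_ : _ = 0) ?add0r.
have [s sE] := duo_mulR duoR a t.
have ee : (t * a) * (t * a) = t * a by rewrite {2}sE mulrA eae sE.
exists (t * a); split=> //.
apply/funext => y; apply/propext; split=> -[r ->]; last by exists (r * t); rewrite mulrA.
by exists (r * a); rewrite -mulrA -(idem_comm a ee) eae.
Qed.

End PrincipalDuo.

(** * Splitting off a torsion summand *)

Section Summands.
Variables (R : pzRingType) (duoR : duo_ring R) (pidR : left_principal R).

(** For such an [x] the module [R x] is a quotient of [R / R p ^+ n], whose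
    submodules form a finite chain. *)
Definition torsion_chain (M : lmodType R) (x : M) : Prop :=
  exists p n, maximal_gen p /\ p ^+ n *: x = 0.

(** [R x] is isomorphic to the domain [R / R e], which is also the direct factor
    [R (1 - e)] of [R]. *)
Definition free_over_prime (M : lmodType R) (x : M) : Prop :=
  exists e, [/\ e * e = e, prime_ideal (left_mult e)
    & forall r, r *: x = 0 <-> left_mult e r].

Definition cyclic_summand (M : lmodType R) (x : M) : Prop :=
  exists N : M -> Prop, [/\ is_submod N, (forall r, N (r *: x) -> r *: x = 0)
    & forall z, exists r, N (z - r *: x)].

Lemma ann_scale (M : lmodType R) r s (x : M) : r *: x = 0 -> r *: (s *: x) = 0.
Proof. exact: (@colon_scale R duoR M (fun z => z = 0) r s x (is_submod0 M)). Qed.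

Section OneModule.
Variables (M : lmodType R).
Hypothesis fgM : finitely_generated M.
Let noeM := fg_noetherian pidR fgM.

Lemma is_submod_scale (N : M -> Prop) a : is_submod N ->
  is_submod (fun z => N (a *: z)).
Proof.
move=> sN; have [N0 ND NZ] := sN; split; first by rewrite scaler0.
  by move=> x y Nx Ny; rewrite scalerDr; apply: ND.
by move=> b x Nx; apply: (colon_scale duoR).
Qed.

Lemma is_submod_image (a : R) : @is_submod R M (fun z => exists w, z = a *: w).
Proof.
split; first by exists 0; rewrite scaler0.
  by move=> _ _ [u ->] [v ->]; exists (u + v); rewrite scalerDr.
move=> b _ [u ->]; have [c cE] := duo_mulR duoR a b.
by exists (c *: u); rewrite !scalerA cE.
Qed.

(** The kernels of the powers of [p] are submodules, by duoness, and form an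
    increasing chain. *)
Lemma torsion_exponent (p : R) : exists k, forall m (x : M),
  p ^+ m *: x = 0 -> p ^+ k *: x = 0.
Proof.
have [|||k Hk] := @stationary_of_fg R M (fun n x => p ^+ n *: x = 0).
- move=> L sL; have [xs Hxs] := (finitely_generatedP M).1 fgM.
  exact: (lspan_submod_fg pidR (xs := xs)).
- by move=> n; apply: (@is_submod_scale (fun x => x = 0)); apply: is_submod0.
- by move=> n x px; rewrite exprS -scalerA px scaler0.
exists k => m x px; have [km|mk] := leqP k m; first exact: Hk km px.
by rewrite -(subnK (ltnW mk)) exprD -scalerA px scaler0.
Qed.

(** Let [p ^+ k.+1] be the exponent of the [p]-power torsion and [x] an element of
    that exact order; then [p ^+ k.+1 *: M] meets [R x] trivially.  Requiring the
    complement [N] to contain [p ^+ k.+1 *: M] amounts to working over a ring where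
    [p] is nilpotent, where the chain module [R x] of maximal length is injective;
    the second half of the proof is the verification of this injectivity. *)
Lemma torsion_summand (p : R) (z : M) :
  maximal_gen p -> p *: z = 0 -> z != 0 ->
  exists x : M, [/\ x != 0, torsion_chain x & cyclic_summand x].
Proof.
move=> maxp pz nz; have [_ dich] := maxp.
have [k [Hk [x [xk nx]]]] : exists k,
    (forall m (x : M), p ^+ m *: x = 0 -> p ^+ k.+1 *: x = 0) /\
    exists x : M, p ^+ k.+1 *: x = 0 /\ p ^+ k *: x <> 0.
  have ex : exists k, `[< forall m (x : M), p ^+ m *: x = 0 -> p ^+ k *: x = 0 >].
    by have [k Hk] := torsion_exponent p; exists k; apply/asboolP.
  case: (ex_minnP ex) => -[|k] /asboolP Hk min.
    by have := Hk 1%N z pz; rewrite expr0 scale1r => z0; rewrite z0 eqxx in nz.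
  exists k; split=> //; apply: contrapT => H.
  have : (k.+1 <= k)%N; last by rewrite ltnn.
  apply: min; apply/asboolP => m x /Hk px; apply: contrapT => nx.
  by apply: H; exists x.
exists x; split.
- by apply/eqP => x0; apply: nx; rewrite x0 scaler0.
- by exists p, k.+1.
set q := p ^+ k.+1.
have annx (r : R) : q *: (r *: x) = 0 by exact: ann_scale.
pose F (N : M -> Prop) := [/\ is_submod N, (forall r, N (r *: x) -> r *: x = 0)
  & forall z, N (q *: z)].
have [_ []//||N [[sN Nx Nq] Nmax]] := @noetherian_max R M F noeM.
  exists (fun z => exists w, z = q *: w); split=> [|r [w rE]|w].
  - exact: is_submod_image.
  - by rewrite rE; apply: (Hk (k.+1 + k.+1)%N); rewrite exprD -scalerA -/q -rE annx.
  - by exists w.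
exists N; split=> // y; apply: contrapT => /forallNP ny.
have [N0 ND NZ] := sN.
(* Some multiple of [y] by a power of [p] is outside [N + R x], but falls into it
   after one more multiplication by [p]. *)
have [w [nw [d pw]]] : exists w, (forall r, ~ N (w - r *: x)) /\
    exists c, N (p *: w - c *: x).
  have exj : exists j, `[< exists c, N (p ^+ j *: y - c *: x) >].
    by exists k.+1; apply/asboolP; exists 0; rewrite scale0r subr0.
  case: (ex_minnP exj) => -[|j] /asboolP[c Hc] min.
    by case: (ny c); rewrite expr0 scale1r in Hc.
  exists (p ^+ j *: y); split; last by exists c; rewrite scalerA -exprS.
  move=> r Hr; have : (j.+1 <= j)%N; last by rewrite ltnn.
  by apply: min; apply/asboolP; exists r.
(* If [d] is invertible modulo [p], then [p ^+ k *: x] is in [N] because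
   [p ^+ k.+1 *: w] is; this contradicts the choice of [x]. *)
have [[c dE]|[s [t E]]] := dich d; last first.
  have pdx : N (p ^+ k *: (d *: x)).
    rewrite -[d *: x](subKr (p *: w)) scalerBr; apply: is_submodB => //; last exact: NZ.
    by rewrite scalerA -exprSr; apply: Nq.
  have dx0 : p ^+ k *: (d *: x) = 0.
    by rewrite scalerA; apply: Nx; rewrite -scalerA.
  have px0 : p ^+ k *: (p *: x) = 0 by rewrite scalerA -exprSr.
  apply: nx; rewrite -[x]scale1r E scalerDl scalerDr -!scalerA.
  by rewrite (ann_scale s dx0) (ann_scale t px0) addr0.
have [b bE] := duo_mulR duoR p c.
(* Correcting [w] by a multiple of [x] puts [p *: v] in [N]; then [N + R v] still
   meets [R x] trivially, against the maximality of [N]. *)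
pose v := w - b *: x.
have pv : N (p *: v) by rewrite scalerBr scalerA -bE -dE.
have nv : ~ N v by exact: nw.
apply: nv; apply: (Nmax (sumS N (cyc v))); last 2 first.
- by move=> u Nu; exists u, 0; rewrite addr0; split=> //; exists 0; rewrite scale0r.
- by exists 0, v; rewrite add0r; split=> //; exists 1; rewrite scale1r.
split=> [|s [n [_ [Nn [r ->] sE]]]|u]; last first.
- by exists (q *: u), 0; rewrite addr0; split=> //; exists 0; rewrite scale0r.
- have [[a rE]|[a [t E]]] := dich r.
    by apply: Nx; rewrite sE rE -scalerA; apply: ND => //; apply: NZ.
  case: (nw (a * s + b)).
  have -> : w - (a * s + b) *: x = t *: (p *: v) - a *: n.
    have -> : w - (a * s + b) *: x = v - a *: (s *: x).
      by rewrite scalerDl opprD addrA addrAC scalerA.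
    have vE : v = t *: (p *: v) + a *: (r *: v).
      by rewrite !scalerA -scalerDl addrC -E scale1r.
    by rewrite sE scalerDr [X in X - _]vE [a *: n + _]addrC addrKA.
  by apply: is_submodB => //; apply: NZ.
- by apply: is_submod_sumS => //; apply: is_submod_cyc.
Qed.

End OneModule.
End Summands.

(** * Splitting off a torsion-free summand *)

Section FreeSummands.
Variables (R : pzRingType) (duoR : duo_ring R) (pidR : left_principal R).
Variables (M : lmodType R).
Hypothesis fgM : finitely_generated M.
Let noeM := fg_noetherian pidR fgM.

(** [M / N] has no simple submodule. *)
Definition socle_free (N : M -> Prop) : Prop :=
  forall p z, maximal_gen p -> N (p *: z) -> N z.

Lemma maximal_socle_free : (exists z : M, z != 0) ->
  socle_free (fun z => z = 0) ->
  exists N : M -> Prop, [/\ is_submod N, (exists z, ~ N z), socle_free N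
    & forall N' : M -> Prop, is_submod N' -> socle_free N' ->
      (forall z, N z -> N' z) -> (exists z, N' z /\ ~ N z) -> forall z, N' z].
Proof.
move=> [z /eqP nz] sf0.
pose F (N : M -> Prop) := [/\ is_submod N, exists z, ~ N z & socle_free N].
have [_ []//||N [[sN pN sfN] Nmax]] := @noetherian_max R M F noeM.
  by exists (fun z => z = 0); split=> //; [apply: is_submod0 | exists z].
exists N; split=> // N' sN' sfN' NN' [w [N'w nw]] u; apply: contrapT => nu.
by apply: nw; apply: (Nmax N') => //; split=> //; exists u.
Qed.

Section Quotient.
Variable N : M -> Prop.
Hypotheses (sN : is_submod N) (sfN : socle_free N).
Hypothesis maxN : forall N' : M -> Prop, is_submod N' -> socle_free N' ->
  (forall z, N z -> N' z) -> (exists z, N' z /\ ~ N z) -> forall z, N' z.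

(** [M / N] is the direct sum of its images under [e] and [1 - e], and dividing out
    either one keeps it free of simple submodules; so by maximality of [N] one of
    them is zero, and it is the first if [e] kills the class of [u]. *)
Lemma idem_absorbed (e : R) u : e * e = e -> ~ N u -> N (e *: u) ->
  forall z, N (e *: z).
Proof.
move=> ee nu Neu z; have [_ _ NZ] := sN.
pose N' := fun z => N ((1 - e) *: z).
have dE v : (1 - e) *: v = v - e *: v by rewrite scalerBl scale1r.
apply: contrapT => nez; apply: nu.
rewrite -[u](subrK (e *: u)); case: sN => _ ND _; apply: ND => //.
rewrite -dE; apply: (maxN (N' := N')) => //.
- exact: (is_submod_scale duoR).
- move=> p v maxp; rewrite /N' !dE scalerA idem_comm // -scalerA -scalerBr.
  exact: sfN.
- by move=> v Nv; apply: NZ.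
- exists (e *: z); split=> //; rewrite /N' dE scalerA ee subrr.
  by case: sN.
Qed.

(** The associated primes of [M / N] are not maximal as [M / N] has no simple
    submodule, so they are generated by idempotents, which annihilate [M / N]. *)
Lemma prime_colon_idem (G : M -> Prop) :
  (exists w, G w) -> (forall w, G w -> ~ N w) ->
  (forall s w, G w -> ~ N (s *: w) -> G (s *: w)) ->
  exists w e, [/\ G w, e * e = e, prime_ideal (left_mult e),
    (forall r, N (r *: w) <-> left_mult e r) & forall z, N (e *: z)].
Proof.
move=> exG GN GZ.
have [w [a [Gw pa Ha]]] := exists_prime_colon duoR pidR sN exG GN GZ.
have nw := GN w Gw.
have [maxa|[e [ee aE]]] := prime_maximal_or_idem duoR pidR pa.
  by case: nw; apply: (sfN maxa); apply/Ha/left_mult_id.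
have Hew : N (e *: w) by apply/Ha; rewrite aE; apply: left_mult_id.
exists w, e; split=> //; first by rewrite -aE.
  by move=> r; rewrite -aE.
exact: idem_absorbed nw Hew.
Qed.

(** If [r *: z] is in [N], some [w] outside [N] with [r *: w] in [N] has an
    associated prime [R f] containing [r].  Since [f] kills all of [M / N], it kills
    [u], whence [R f] is contained in [R e]. *)
Lemma quotient_torsion_free : (exists z, ~ N z) ->
  exists u e, [/\ ~ N u, e * e = e, prime_ideal (left_mult e),
    (forall z, N (e *: z)) & forall r z, ~ N z -> N (r *: z) -> left_mult e r].
Proof.
move=> exN.
have [//|//|//|u [e [nu ee pe He eN]]] := @prime_colon_idem (fun w => ~ N w).
exists u, e; split=> // r z nz Nrz.
have [|||w [f [[nw Nrw] ff pf Hf fN]]] :=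
  @prime_colon_idem (fun w => ~ N w /\ N (r *: w)).
- by exists z.
- by move=> w [].
- by move=> s w [nw Nw] nsw; split=> //; apply: (colon_scale duoR).
have /Hf[s ->] := Nrw; apply: left_mult_mull; exact/He.
Qed.

(** The elements of [M / N] having a nonzero multiple in [R u] form a submodule with
    socle-free quotient, hence are all of [M / N]: it has rank one.  As [M] is
    finitely generated, one scalar [d] outside [R e] maps [M / N] into [R u], onto
    the submodule [R b u] with [b = d v] modulo [N].  Multiplication by [d] is only
    semilinear, but duoness lets a relation [d z = s d v] be rewritten as
    [d (z - t v) = 0], and torsion-freeness then gives [z = t v]. *)
Lemma quotient_cyclic : (exists z, ~ N z) ->
  exists v e, [/\ e * e = e, prime_ideal (left_mult e), ~ N v,
    (forall z, N (e *: z)) /\ (forall r z, ~ N z -> N (r *: z) -> left_mult e r)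
    & forall z, exists r, N (z - r *: v)].
Proof.
move=> exN; have [u [e [nu ee pe eN tf]]] := quotient_torsion_free exN.
have [N0 ND NZ] := sN; have [ne1 prime_e] := pe.
have mulne x y : ~ left_mult e x -> ~ left_mult e y -> ~ left_mult e (x * y).
  by move=> nx ny /prime_e[].
pose V z := exists d c, ~ left_mult e d /\ N (d *: z - c *: u).
have sV : is_submod V.
  split; first by exists 1, 0; rewrite scaler0 scale0r subr0.
    move=> x y [d [c [nd H]]] [d' [c' [nd' H']]].
    have [s sE] := duo_mulL duoR d d'.
    exists (d * d'), (s * c + d * c'); split; first exact: mulne.
    rewrite scalerDr scalerDl opprD addrACA {1}sE -!scalerA -!scalerBr.
    by apply: ND; apply: NZ.
  move=> a x [d [c [nd H]]]; have [s sE] := duo_mulL duoR d a.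
  exists d, (s * c); split=> //.
  by rewrite scalerA sE -!scalerA -scalerBr; apply: NZ.
have Vall : forall z, V z.
  apply: maxN => //.
  - move=> p z maxp [d [c [nd H]]].
    have [[r rE]|np] := pselect (left_mult e p).
      have Nz : N z by apply: (sfN maxp); rewrite rE -scalerA; apply: NZ.
      by exists 1, 0; rewrite scale1r scale0r subr0.
    by exists (d * p), c; split; [exact: mulne | rewrite -scalerA].
  - by move=> z Nz; exists 1, 0; rewrite scale1r scale0r subr0.
  - by exists u; split=> //; exists 1, 1; rewrite scale1r subrr.
(* A common denominator of all elements is the product of the denominators of the
   generators. *)
have [d [nd Hd]] : exists d, ~ left_mult e d /\ forall z, exists c, N (d *: z - c *: u).
  have [xs Hxs] := (finitely_generatedP M).1 fgM.
  suff [d [nd H]] : exists d, ~ left_mult e d /\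
      forall z, lspan xs z -> exists c, N (d *: z - c *: u).
    by exists d; split=> // z; apply: H.
  elim: (xs) => [|y ys [d' [nd' H']]].
    exists 1; split=> // _ ->; exists 0; by rewrite scaler0 scale0r subr0.
  have [d [c [nd H]]] := Vall y.
  exists (d * d'); split; first exact: mulne.
  move=> z [r /H'[c' Hc']].
  have [s sE] := duo_mulL duoR d (d' * r).
  exists (s * c + d * c').
  have -> : (d * d') *: z - (s * c + d * c') *: u =
      s *: (d *: y - c *: u) + d *: (d' *: (z - r *: y) - c' *: u).
    rewrite !scalerBr !scalerA -sE scalerDl opprD !mulrA.
    by rewrite [RHS]addrACA subrKC.
  by apply: ND; apply: NZ.
pose D := fun c : R => exists z, N (d *: z - c *: u).
have sD : @is_submod R R^o D.
  split; first by exists 0; rewrite scaler0 scale0r subr0.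
    move=> b c [x Hx] [y Hy]; exists (x + y).
    by rewrite scalerDr scalerDl opprD addrACA; apply: ND.
  move=> a c [x Hx]; have [s sE] := duo_mulR duoR d a.
  by exists (s *: x); rewrite scalerA -sE -!scalerA -scalerBr; apply: NZ.
have [b Hb] := pidR sD.
have [v Hv] : D b by apply/Hb/left_mult_id.
have gen z : exists r, N (z - r *: v).
  have [c Hc] := Hd z; have /Hb[s cE] : D c by exists z.
  have [t tE] := duo_mulR duoR d s.
  exists t; apply: contrapT => nz; apply: nd; apply: tf nz _.
  have -> : d *: (z - t *: v) = (d *: z - c *: u) - s *: (d *: v - b *: u).
    by rewrite cE !scalerBr !scalerA -tE opprB addrA subrK.
  by apply: is_submodB => //; apply: NZ.
exists v, e; split=> // Nv; apply: nu; have [r Hr] := gen u.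
by rewrite -[u](subrK (r *: v)); apply: ND => //; apply: NZ.
Qed.

End Quotient.

(** The generator of [M / N] is lifted to [v - e *: v], which [e] kills exactly and
    not only modulo [N]; its span then meets [N] trivially. *)
Lemma free_summand : (exists z : M, z != 0) -> socle_free (fun z => z = 0) ->
  exists x : M, [/\ x != 0, free_over_prime x & cyclic_summand x].
Proof.
move=> nzM sf0; have [N [sN exN sfN maxN]] := maximal_socle_free nzM sf0.
have [v [e [ee pe nv [eN tf] gen]]] := quotient_cyclic sN sfN maxN exN.
have [N0 ND NZ] := sN.
pose x := v - e *: v.
have ex0 : e *: x = 0 by rewrite scalerBr scalerA ee subrr.
have nx : ~ N x.
  by move=> Nx; apply: nv; rewrite -[v](subrK (e *: v)); apply: ND.
have annx r : N (r *: x) -> left_mult e r by exact: tf.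
have xann r : left_mult e r -> r *: x = 0.
  by move=> [s ->]; rewrite -scalerA ex0 scaler0.
exists x; split.
- by apply/eqP => x0; apply: nx; rewrite x0.
- by exists e; split=> // r; split=> [rx|]; [apply: annx; rewrite rx | exact: xann].
exists N; split=> // [r /annx|z]; first exact: xann.
have [r Hr] := gen z; exists r; rewrite scalerBr opprB addrCA addrC.
by apply: ND => //; apply: NZ.
Qed.

End FreeSummands.

(** * Cyclic modules with a prescribed annihilator *)

Section CyclicModules.
Variables (R : pzRingType) (duoR : duo_ring R) (pidR : left_principal R).

Lemma submod_gen (M : lmodType R) (N : submodClosed M) (y : submod N) :
  (forall z, z \in N -> cyc (val y) z) -> forall z : submod N, cyc y z.
Proof.
move=> gen z; have [r zE] := gen _ (valP z).
by exists r; apply: val_inj.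
Qed.

Lemma cyclic_submod_gen (M : lmodType R) (x : M) (N : submodClosed M) :
  (forall z, cyc x z) ->
  exists a (y : submod N), val y = a *: x /\ forall z, cyc y z.
Proof.
move=> genx.
have [a Ha] := pidR (is_submod_colon x (submodClosed_is_submod N)).
have yN : a *: x \in N by apply/Ha/left_mult_id.
exists a, (Submod yN); split=> //; apply: submod_gen => z zN.
have [r zE] := genx z; have /Ha[s rE] : r *: x \in N by rewrite -zE.
by exists s; rewrite zE rE scalerA.
Qed.

(** In this section [M] is a nonzero cyclic module killed by a power of [p]; its
    radical is shown to be [p *: M], with simple quotient. *)
Section ChainQuotient.
Variables (M : lmodType R) (p : R) (n : nat) (y : M).
Hypotheses (maxp : maximal_gen p) (geny : forall z, cyc y z)
  (yn : p ^+ n *: y = 0) (nzM : nonzero_module M).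

Let pM (z : M) := exists w, z = p *: w.

Let chain_kill (z : M) : p ^+ n *: z = 0.
Proof. by have [r ->] := geny z; apply: ann_scale. Qed.

(** If [L + p *: M = M] then [L + p ^+ n *: M = M], and [p ^+ n *: M] is zero. *)
Let power_image (L : M -> Prop) : is_submod L ->
  (forall z, exists l w, L l /\ z = l + p *: w) -> forall z, L z.
Proof.
move=> sL H z; have [_ LD LZ] := sL.
suff [l [w [Ll ->]]] : exists l w, L l /\ z = l + p ^+ n *: w.
  by rewrite chain_kill addr0.
elim: (n) => [|k [l [w [Ll ->]]]].
  by exists 0, z; rewrite expr0 scale1r add0r; split=> //; case: sL.
have [l' [w' [Ll' ->]]] := H w.
exists (l + p ^+ k *: l'), w'; split; first by apply: LD => //; apply: LZ.
by rewrite scalerDr addrA scalerA -exprSr.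
Qed.

Let pM_or_gen (r : R) : pM (r *: y) \/ exists s, pM (y - s *: (r *: y)).
Proof.
have [_ dich] := maxp; have [[s ->]|[s [t E]]] := dich r; [left|right].
  have [q ->] := duo_mulR duoR p s; by exists (q *: y); rewrite scalerA.
exists s; have [q qE] := duo_mulR duoR p t; exists (q *: y).
by rewrite -[y in y - _]scale1r E scalerDl addrC scalerA addKr scalerA qE.
Qed.

Let y_notin_pM : ~ pM y.
Proof.
move=> [w yE]; have [x /eqP nx] := nzM; apply: nx.
apply: (power_image (L := fun z => z = 0)); first exact: is_submod0.
move=> z; have [r ->] := geny z; have [q qE] := duo_mulR duoR p r.
by exists 0, (q *: w); rewrite add0r yE !scalerA qE.
Qed.

(** [p *: M] is a maximal submodule by [pM_or_gen], and every maximal submodule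
    contains it: otherwise the two would add up to [M], against [power_image]. *)
Let Rad_pM x : x \in Rad M <-> pM x.
Proof.
have [_ pD pZ] := is_submod_image duoR M p.
split=> [/RadP radx|[w ->]].
  have [T HT] := submodClosed_of (is_submod_image duoR M p).
  apply/HT/radx; split; first by exists y; apply/negP => /HT.
  move=> L TL; have [yL|nyL] := boolP (y \in L); [right|left].
    by move=> z; have [r ->] := geny z; apply: rpredZ.
  move=> z; apply/idP/idP => [zL|]; last exact: TL.
  have [r zE] := geny z; have [pz|[s ps]] := pM_or_gen r.
    by apply/HT; rewrite zE.
  case/negP: nyL; rewrite -[y](subrK (s *: z)) rpredD ?rpredZ //.
  by apply/TL/HT; rewrite zE.
apply/RadP => L [[u /negP nu] maxL]; apply: contrapT => npw.
have sL := submodClosed_is_submod L.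
have [K HK] := submodClosed_of (is_submod_sumS sL (is_submod_image duoR M p)).
have LK : {subset L <= K}.
  move=> z zL; apply/HK; exists z, 0; rewrite addr0; split=> //.
  by exists 0; rewrite scaler0.
have [KL|Kall] := maxL K LK.
  apply: npw; rewrite -KL; apply/HK; exists 0, (p *: w).
  by rewrite add0r rpred0; split=> //; exists w.
apply: nu; apply: (power_image (L := fun z => z \in L)) => // z.
by have /HK[l [_ [Ll [v ->] ->]]] := Kall z; exists l, v.
Qed.

Lemma chain_quotient_Rad :
  cyclic_module (quotmod (Rad M)) /\ uniform_module (quotmod (Rad M)).
Proof.
pose pi := pi_quotmod (Rad M).
have piZ a z : pi (a *: z) = a *: pi z by rewrite /pi -scale_pi_quotmod.
have pi0 z : pM z -> pi z = 0.
  move=> /Rad_pM zR; rewrite -[0](scale0r (pi 0)) -piZ scale0r.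
  by apply/pi_quotmod_eq; rewrite subr0.
have piy : pi y <> 0.
  rewrite -[0](scale0r (pi 0)) -piZ scale0r => /pi_quotmod_eq.
  by rewrite subr0 => /Rad_pM.
have gen q : exists r, q = pi (r *: y).
  by have [r E] := geny (repr q); exists r; rewrite /pi -E pi_quotmod_repr.
split; first by exists (pi y) => q; have [r ->] := gen q; exists r.
(* The quotient is simple, since each of its nonzero elements has a multiple equal
   to the class of the generator. *)
have main (L : submodClosed (quotmod (Rad M))) :
    (exists2 q, q \in L & q != 0) -> pi y \in L.
  move=> [q qL /eqP nq]; have [r qE] := gen q.
  have [/pi0|[s /Rad_pM ps]] := pM_or_gen r; first by rewrite -qE.
  suff -> : pi y = s *: q by exact: rpredZ.
  by rewrite qE -piZ; apply/pi_quotmod_eq.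
split; first by exists (pi y); apply/eqP.
move=> K [q nq] L nzL; exists (pi y); split; last exact/eqP.
  apply: main; exists (val q); first exact: valP.
  by apply: contra_neq nq => qE; apply: val_inj.
exact: main.
Qed.

End ChainQuotient.

Lemma torsion_chain_cu (M : lmodType R) (x : M) :
  (forall z, cyc x z) -> torsion_chain x -> cu_uniserial M.
Proof.
move=> genx [p [n [maxp xn]]] K _ nzK.
have [a [y [yE geny]]] := cyclic_submod_gen K genx.
apply: (chain_quotient_Rad (p := p) (n := n) (y := y)) => //.
by apply: val_inj; rewrite linearZ /= yE; apply: ann_scale.
Qed.

(** To lift along a surjection, send [x] to [1 - e] times any preimage of its
    image. *)
Lemma free_projective (M : lmodType R) (x : M) :
  (forall z, cyc x z) -> free_over_prime x -> projective_module M.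
Proof.
move=> genx [e [ee _ ann]] A B g f surj.
have [a aE] := surj (f x).
have [|h hE] := cyclic_linear (y := (1 - e) *: a) genx.
  move=> r /ann[s ->].
  by rewrite scalerA mulrBr mulr1 -mulrA ee subrr scale0r.
exists h => z; have [r ->] := genx z; rewrite hE linearZ linearZ aE -linearZ -linearZ.
congr (f _); rewrite scalerBl scale1r (_ : e *: x = 0) ?subr0 //.
exact/ann/left_mult_id.
Qed.

(** A nonzero submodule is cyclic, generated by [a *: x] with [a] outside the prime
    [R e], so [a *: x] and [x] have the same annihilator. *)
Lemma free_virtually_simple (M : lmodType R) (x : M) :
  (forall z, cyc x z) -> free_over_prime x -> virtually_simple M.
Proof.
move=> genx [e [ee [ne1 prime_e] ann]].
split.
  by exists x; apply/eqP => x0; apply/ne1/ann; rewrite x0 scaler0.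
move=> N [u nu]; have [a [y [yE geny]]] := cyclic_submod_gen N genx.
have na : ~ left_mult e a.
  move=> /ann ax; have [r uE] := geny u; case/eqP: nu.
  by rewrite uE (_ : y = 0) ?scaler0 //; apply: val_inj; rewrite yE.
apply: (cyclic_iso geny genx) => r; split=> [ry|/ann er].
  have /ann/prime_e[/ann//|//] : (r * a) *: x = 0.
  by rewrite -scalerA -yE -[r *: val y]/(val (r *: y)) ry.
apply: val_inj; rewrite linearZ /= yE scalerA; apply/ann.
exact: left_mult_mulr.
Qed.

End CyclicModules.

(** * Independent families *)

Section Independence.
Variables (R : pzRingType) (M : lmodType R).

Fixpoint indep (xs : seq M) : Prop :=
  if xs is y :: ys then (forall r, lspan ys (r *: y) -> r *: y = 0) /\ indep ys
  else True.

Lemma lspan_sub (xs ys : seq M) z : {subset xs <= ys} -> lspan xs z -> lspan ys z.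
Proof.
move=> sub; apply: lspan_min => [|x /sub]; [exact: lspan_submod | exact: lspan_mem].
Qed.

Lemma lspan_filter (a : pred M) xs z :
  lspan [seq x <- xs | a x] z -> lspan xs z.
Proof. by apply: lspan_sub => x; rewrite mem_filter => /andP[]. Qed.

Lemma indep_filter (a : pred M) xs : indep xs -> indep [seq x <- xs | a x].
Proof.
elim: xs => //= y ys IH [indy /IH]; case: (a y) => //= indys.
by split=> // r /lspan_filter/indy.
Qed.

Lemma indep_disjoint (a : pred M) xs z : indep xs ->
  lspan [seq x <- xs | a x] z -> lspan [seq x <- xs | ~~ a x] z -> z = 0.
Proof.
elim: xs => //= y ys IH [indy indys].
have key A B r : {subset A <= ys} -> {subset B <= ys} ->
    lspan A (z - r *: y) -> lspan B z -> lspan A z.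
  move=> Ays Bys /[dup] Az /(lspan_sub Ays) z1 /(lspan_sub Bys) z2.
  suff ry0 : r *: y = 0 by move: Az; rewrite ry0 subr0.
  apply: indy; rewrite -[r *: y](subKr z).
  by apply: is_submodB => //; apply: lspan_submod.
have sub (b : pred M) : {subset [seq x <- ys | b x] <= ys}.
  by move=> x; rewrite mem_filter => /andP[].
case: (a y) => /= [[r Hr] Hz|Hz [r Hr]]; apply: IH => //.
  exact: key Hr Hz.
exact: key Hr Hz.
Qed.

Lemma lspan_split (a : pred M) xs z : lspan xs z ->
  exists u v, [/\ lspan [seq x <- xs | a x] u, lspan [seq x <- xs | ~~ a x] v
    & z = u + v].
Proof.
elim: xs z => [|y ys IH] z /=; first by move=> ->; exists 0, 0; rewrite addr0.
move=> [r /IH[u [v [Hu Hv E]]]]; rewrite -[z](subrK (r *: y)) E.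
case: (a y) => /=.
  exists (r *: y + u), v; split=> //; first exact: lspan_cons.
  by rewrite addrC addrA.
exists u, (r *: y + v); split=> //; first exact: lspan_cons.
by rewrite -addrA [v + _]addrC.
Qed.

(** The recursive form of independence yields the usual one. *)
Lemma indep_sum xs (c : nat -> R) : indep xs ->
  \sum_(i < size xs) c i *: xs`_i = 0 ->
  forall i, (i < size xs)%N -> c i *: xs`_i = 0.
Proof.
elim: xs c => //= y ys IH c [indy indys]; rewrite big_ord_recl /= => E.
have cy : c 0%N *: y = 0.
  apply: indy; rewrite -[c 0%N *: y]opprK (addr0_eq E).
  have [S0 SD SZ] := lspan_submod ys.
  apply: (is_submodN (lspan_submod ys)); apply: (big_ind (lspan ys)) => // i _.
  by apply: SZ; apply/lspan_mem/mem_nth; apply: ltn_ord.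
move=> [|i] // ilt; apply: (IH (fun i => c i.+1)) => //.
by move: E; rewrite cy add0r.
Qed.

(** An independent list generating [D] decomposes [D] into cyclic modules, whose
    generators [x] are compared with those in the list only through their
    annihilators, as they live in a different module. *)
Lemma direct_sum_lspan (C : lmodType R -> Prop) (xs : seq M) (D : submodClosed M) :
  indep xs -> (forall z, z \in D <-> lspan xs z) ->
  (forall (X : lmodType R) (x : X) (x0 : M), x0 \in xs -> (forall z, cyc x z) ->
     (forall r, r *: x = 0 <-> r *: x0 = 0) -> C X) ->
  direct_sum_of C (submod D).
Proof.
move=> ind DE HC; pose I := 'I_(size xs).
have xsD (i : I) : xs`_i \in D by apply/DE/lspan_mem/mem_nth.
pose g (i : I) : submod D := Submod (xsD i).
have [N HN] := choice (fun i => submodClosed_of (is_submod_cyc (g i))).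
exists I, N; split; last first.
  move=> i; have gN : g i \in N i by apply/HN; exists 1; rewrite scale1r.
  apply: (HC _ (Submod gN) xs`_i); first exact: mem_nth.
    by apply: submod_gen => z /HN.
  move=> r; split=> [/(congr1 (val \o val)) //|rx].
  by apply: val_inj; apply: val_inj.
split=> [x|s f us Nf sum0 i iS].
  have /DE/lspan_sum[c cE] := valP x.
  exists (index_enum I), (fun i : I => c i *: g i).
  split; first exact: index_enum_uniq.
    by move=> i; apply/HN; exists (c i).
  by apply: val_inj; rewrite linear_sum cE.
have [c cE] := choice (fun i => (HN i (f i)).1 (Nf i)).
pose d k := if insub k is Some j then if j \in s then c j else 0 else 0.
have dE (j : I) : d j *: xs`_j = if j \in s then val (f j) else 0.
  by rewrite /d valK; case: ifP => _; rewrite ?scale0r // cE.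
suff : d i *: xs`_i = 0 by rewrite dE iS => fi0; apply: val_inj.
apply: (indep_sum ind) => //.
under eq_bigr => j _ do rewrite dE.
rewrite -big_mkcond /= -big_uniq //.
by rewrite -[RHS]/(val (0 : submod D)) -sum0 linear_sum.
Qed.

End Independence.

(** * Decomposition of finitely generated modules *)

Section Decomposition.
Variables (R : pzRingType) (duoR : duo_ring R) (pidR : left_principal R).

Lemma torsion_chain_ann (X Y : lmodType R) (x : X) (y : Y) :
  (forall r, r *: x = 0 -> r *: y = 0) -> torsion_chain x -> torsion_chain y.
Proof. by move=> ann [p [n [maxp /ann px]]]; exists p, n. Qed.

Lemma free_over_prime_ann (X Y : lmodType R) (x : X) (y : Y) :
  (forall r, r *: x = 0 <-> r *: y = 0) -> free_over_prime x -> free_over_prime y.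
Proof. by move=> ann [e [ee pe H]]; exists e; split=> // r; rewrite -ann. Qed.

(** The two kinds of summands correspond to whether [M] has a simple submodule. *)
Lemma exists_cyclic_summand (M : lmodType R) : finitely_generated M ->
  (exists z : M, z != 0) -> exists x : M,
  [/\ x != 0, torsion_chain x \/ free_over_prime x & cyclic_summand x].
Proof.
move=> fgM nzM.
have [sf|] := pselect (@socle_free R M (fun z => z = 0)).
  have [x [nx fx sx]] := free_summand duoR pidR fgM nzM sf.
  by exists x; split=> //; right.
move=> /existsNP[p /existsNP[z /not_implyP[maxp /not_implyP[pz /eqP nz]]]].
have [x [nx tx sx]] := torsion_summand duoR pidR fgM maxp pz nz.
by exists x; split=> //; left.
Qed.

(** Take a maximal submodule among those which are direct sums of cyclic modules of
    the two kinds and have a complement [N].  If [N] were nonzero, a cyclic summand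
    of [N] could be added to the list. *)
Lemma cyclic_decomposition (M : lmodType R) : finitely_generated M ->
  exists xs : seq M, [/\ indep xs, forall z, lspan xs z
    & forall x, x \in xs -> torsion_chain x \/ free_over_prime x].
Proof.
move=> fgM; have noeM := fg_noetherian pidR fgM.
pose F (S : M -> Prop) := exists xs (N : M -> Prop),
  [/\ S = lspan xs, indep xs,
    forall x, x \in xs -> torsion_chain x \/ free_over_prime x
    & [/\ is_submod N, forall z, N z -> lspan xs z -> z = 0
        & forall z, exists u, lspan xs u /\ N (z - u)]].
have [_ [xs [N [-> _ _ _]]]||S [[xs [N [-> ind good [sN capN sumN]]]] Smax]] :=
    @noetherian_max R M F noeM.
- exact: lspan_submod.
- exists (lspan [::]), [::], (fun=> True); split=> //; split=> // z.
  by exists 0.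
exists xs; split=> // z; have [N0 ND NZ] := sN.
suff Ntriv w : N w -> w = 0.
  have [u [Su /Ntriv/eqP]] := sumN z.
  by rewrite subr_eq0 => /eqP->.
move=> Nw; apply: contrapT => /eqP nw.
have [W HW] := submodClosed_of sN.
have [] := @exists_cyclic_summand (submod W).
- exact/noetherian_fg/noetherian_submod.
- have wW : w \in W by apply/HW.
  by exists (Submod wW); apply: contra_neq nw => /(congr1 val).
move=> x [nx goodx [K [sK capK sumK]]].
have [K0 KD KZ] := sK.
have Nx : N (val x) by apply/HW/valP.
have goodvx : torsion_chain (val x) \/ free_over_prime (val x).
  case: goodx => [tx|fx]; [left|right].
    by apply: torsion_chain_ann tx => r rx; rewrite -linearZ rx.
  apply: free_over_prime_ann fx => r; rewrite -linearZ.
  by split=> [->//|rx]; apply: val_inj.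
suff xS : lspan xs (val x).
  by case/eqP: nx; apply: val_inj; exact: (capN _ Nx xS).
apply: (Smax (lspan (val x :: xs))); last by apply: lspan_mem; rewrite mem_head.
  exists (val x :: xs), (fun z => exists2 k, K k & z = val k); split=> //.
  - by split=> // r; apply: capN; apply: NZ.
  - by move=> y; rewrite inE => /orP[/eqP->|/good].
  split.
  - split; first by exists 0.
      by move=> _ _ [k Kk ->] [l Kl ->]; exists (k + l) => //; apply: KD.
    by move=> a _ [k Kk ->]; exists (a *: k) => //; apply: KZ.
  - move=> _ [k Kk ->] [r Hr].
    have kE : k = r *: x.
      apply: val_inj; apply: subr0_eq; apply: capN Hr.
      by apply: is_submodB => //; [exact/HW/valP | exact: NZ].
    by rewrite kE capK // -kE.
  - move=> y; have [u [Su Nyu]] := sumN y.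
    have yuW : y - u \in W by apply/HW.
    have [r Kr] := sumK (Submod yuW).
    exists (r *: val x + u); split; first exact: lspan_cons.
    exists (Submod yuW - r *: x) => //=.
    by rewrite opprD addrA addrAC.
by move=> y; apply: lspan_tail.
Qed.

Lemma duo_principal_decomposition (M : lmodType R) : finitely_generated M ->
  exists Z P : submodClosed M,
    internal_direct_sum2 Z P /\
    noetherian_module (submod Z) /\ cu_serial (submod Z) /\
    direct_sum_of
      (fun N : lmodType R => projective_module N /\ virtually_simple N)
      (submod P).
Proof.
move=> fgM; have [xs [ind gen good]] := cyclic_decomposition fgM.
pose a (x : M) := `[< torsion_chain x >].
have [Z HZ] := submodClosed_of (lspan_submod [seq x <- xs | a x]).
have [P HP] := submodClosed_of (lspan_submod [seq x <- xs | ~~ a x]).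
exists Z, P; split; [split|split; [|split]].
- move=> z; have [u [v [Hu Hv ->]]] := lspan_split a (gen z).
  by exists u, v; split=> //; [apply/HZ | apply/HP].
- by move=> z /HZ zZ /HP zP; apply: indep_disjoint ind zZ zP.
- exact/noetherian_submod/fg_noetherian.
- apply: (direct_sum_lspan (indep_filter a ind) HZ) => X x x0.
  rewrite mem_filter => /andP[/asboolP tx0 _] genx ann.
  apply: torsion_chain_cu genx _ => //.
  by apply: torsion_chain_ann tx0 => r /ann.
- apply: (direct_sum_lspan (indep_filter (predC a) ind) HP) => X x x0.
  rewrite mem_filter => /andP[/asboolPn ntx0 x0xs] genx ann.
  have fx : free_over_prime x.
    have [//|fx0] := good x0 x0xs.
    by apply: free_over_prime_ann fx0 => r; split=> /ann.
  by split; [apply: free_projective fx | apply: free_virtually_simple fx].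
Qed.

End Decomposition.

Theorem theorem3p15 (R : pzRingType) (duoR : duo_ring R) :
  principal_ideal_ring R <->
  (forall M : lmodType R, finitely_generated M ->
     exists Z P : submodClosed M,
       internal_direct_sum2 Z P /\
       noetherian_module (submod Z) /\ cu_serial (submod Z) /\
       direct_sum_of
         (fun N : lmodType R => projective_module N /\ virtually_simple N)
         (submod P)).
Proof.
rewrite (duo_principalP duoR); split=> [pidR M|dec].
  exact: duo_principal_decomposition.
have [|Z [P [dZP [noeZ [cuZ [J [L [dL cL]]]]]]]] := dec R^o.
  apply/finitely_generatedP; exists [:: 1] => z; exists z.
  by rewrite /= -[z *: _]/(z * 1) mulr1 subrr.
apply: (left_principal_of_decomposition duoR dZP noeZ cuZ).
by exists J, L; split=> // j; case: (cL j).
Qed.
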